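(* Let $p\ge1$ be an integer, $H>0$, $\beta\in[0,1/p]$ with $\beta<1$, and let $\{x_k\}_{k\ge0}$, $\{\upsilon_k\}_{k\ge0}$ and $\{\Psi_k\}_{k\ge0}$ be generated by the Accelerated Inexact High-Order Proximal-Point Algorithm described in the context. Then: (i) for all $k\ge0$, $A_kF(x_k)\le\Psi_k^*:=\min_{x\in\mathrm{dom}\,\psi}\Psi_k(x)$; (ii) for all $k\ge1$, $$F(x_k)-F^*\le\frac{H}{2(1-\beta)}\,d_{p+1}(x_0-x^* )\left(\frac{2p+2}{k}\right)^{p+1};$$ (iii) for all $k\ge0$, $d_{p+1}(\upsilon_k-x^* )\le2^{p-1}d_{p+1}(x_0-x^* )$.
   Context: $\mathbb{E}$ is a finite-dimensional real vector space with dual $\mathbb{E}^*$; $B:\mathbb{E}\to\mathbb{E}^*$ is a self-adjoint positive-definite operator, $\|x\|=\langle Bx,x\rangle^{1/2}$ on $\mathbb{E}$ and $\|g\|_*=\langle g,B^{-1}g\rangle^{1/2}$ on $\mathbb{E}^*$. $d_{p+1}(x)=\frac{1}{p+1}\|x\|^{p+1}$. $f:\mathbb{E}\to\mathbb{R}$ is convex and differentiable, $\psi:\mathbb{E}\to\mathbb{R}\cup\{+\infty\}$ is proper closed convex with effective domain $\mathrm{dom}\,\psi$, and $F=f+\psi$. The problem $\min_{x\in\mathrm{dom}\,\psi}F(x)$ has an optimal solution $x^*\in\mathrm{dom}\,\psi$, and $F^*=F(x^* )$. For $\bar x\in\mathbb{E}$, let $f_{\bar x,H}^p(x)=f(x)+H\,d_{p+1}(x-\bar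 x)$ and $$\mathcal{A}_H^p(\bar x,\beta)=\{(x,g)\in\mathrm{dom}\,\psi\times\mathbb{E}^*:\ g\in\partial\psi(x),\ \|\nabla f_{\bar x,H}^p(x)+g\|_*\le\beta\|\nabla f(x)+g\|_*\}.$$ With $c_p=\left(\frac{1-\beta}{H}\right)^{1/p}$, set $A_k=\left(\frac{c_p}{2}\right)^p\left(\frac{k}{p+1}\right)^{p+1}$ and $a_{k+1}=A_{k+1}-A_k$ for $k\ge0$. Algorithm: start from $x_0\in\mathrm{dom}\,\psi$ and $\Psi_0(x)=d_{p+1}(x-x_0)$. For $k=0,1,2,\dots$: compute $\upsilon_k=\arg\min_{x\in\mathbb{E}}\Psi_k(x)$; set $y_k=\frac{A_k}{A_{k+1}}x_k+\frac{a_{k+1}}{A_{k+1}}\upsilon_k$; compute some $(T_k,g_k)\in\mathcal{A}_H^p(y_k,\beta)$; choose any $x_{k+1}\in\mathrm{dom}\,\psi$ with $F(x_{k+1})\le F(T_k)$; set $$\Psi_{k+1}(x)=\Psi_k(x)+a_{k+1}\left[f(T_k)+\langle\nabla f(T_k),x-T_k\rangle+\psi(x)\right].$$ *)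

(* Defs.v *)
(* MathComp-Analysis, over an arbitrary R : realType. *)
From HB Require Import structures.
From mathcomp Require Import all_boot all_order all_algebra.
From mathcomp Require Import all_classical all_reals all_analysis.
Set Implicit Arguments.
Unset Strict Implicit.
Unset Printing Implicit Defensive.
Import Order.TTheory GRing.Theory Num.Theory.
Import numFieldNormedType.Exports.
Local Open Scope classical_set_scope.
Local Open Scope ring_scope.

#[short(type="finDimNormedModType")]
HB.structure Definition FinDimNormedModule (R : realType) :=
  {E of NormedModule R E & Vector R E}.

Section Definitions.
Context {R : realType} {E : finDimNormedModType R}.

(* The dual space is 'Hom(E, R^o) and the pairing <g, x> is g x. *)
Implicit Types (B : 'Hom(E, 'Hom(E, R^o))) (g : 'Hom(E, R^o)).
Implicit Types (f : E -> R^o) (psi phi : E -> \bar R) (S : set E) (x y v : E).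

Definition self_adjoint B := forall x y, B x y = B y x.

Definition positive_definite B := forall x, x != 0 -> 0 < B x x.

(* The norm `|x| of E is the one induced by B, so that differentiability,
   closedness and the function d_{p+1} all refer to it. *)
Definition norm_induced_by B := forall x, `|x| = Num.sqrt (B x x).

(* For positive-definite B, B^-1%VF is a genuine two-sided inverse, E and its
   dual having the same dimension. *)
Definition dual_norm B g : R := Num.sqrt (g (B^-1%VF g)).

(* The power prox-function d_{p+1}. *)
Definition dprox (p : nat) x : R := p.+1%:R^-1 * `|x| ^+ p.+1.

Definition grad f x : 'Hom(E, R^o) := linfun ('d f x).

Definition edom psi : set E := [set x | (psi x < +oo)%E].

(* psi takes its values in R `|` {+oo} and is not identically +oo. *)
Definition proper_efun psi := (forall x, psi x != -oo%E) /\ edom psi !=set0.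

Definition convex_efun psi := forall (t : R) x y, 0 <= t <= 1 ->
  (psi (t *: x + (1 - t) *: y)%R <= t%:E * psi x + (1 - t)%:E * psi y)%E.

Definition epigraph psi : set (E * R^o) := [set z | (psi z.1 <= z.2%:E)%E].

Definition closed_efun psi := closed (epigraph psi).

Definition subdifferential psi x : set 'Hom(E, R^o) :=
  [set g | forall y, (psi x + (g (y - x)%R)%:E <= psi y)%E].

Definition composite f psi : E -> \bar R := fun x => ((f x)%:E + psi x)%E.

Definition argmin_on S phi : set E :=
  [set v | S v /\ forall x, S x -> (phi v <= phi x)%E].

(* m is the minimum, in particular attained, of phi on S *)
Definition is_min_on S phi (m : \bar R) :=
  exists2 v, argmin_on S phi v & phi v = m.

Definition prox_objective f (p : nat) (H : R) (xbar : E) : E -> R^o :=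
  fun x => f x + H * dprox p (x - xbar).

Definition acceptable B f psi (p : nat) (H : R) (xbar : E) (beta : R) :
    set (E * 'Hom(E, R^o)) :=
  [set Tg | [/\ edom psi Tg.1, subdifferential psi Tg.1 Tg.2 &
    dual_norm B (grad (prox_objective f p H xbar) Tg.1 + Tg.2)
      <= beta * dual_norm B (grad f Tg.1 + Tg.2)]].

End Definitions.

Section Coefficients.
Context {R : realType}.
Variables (p : nat) (H beta : R).

Definition c_coef : R := ((1 - beta) / H) `^ p%:R^-1.

Definition A_coef (k : nat) : R :=
  (c_coef / 2) ^+ p * (k%:R / p.+1%:R) ^+ p.+1.

(* a_coef k is the coefficient a_{k+1} *)
Definition a_coef (k : nat) : R := A_coef k.+1 - A_coef k.

End Coefficients.

(* The sequences (x_k), (v_k), (y_k), (T_k, g_k) and (Psi_k) form a run of the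
   accelerated inexact high-order proximal-point algorithm, started at x 0. *)
Record accelerated_run (R : realType) (E : finDimNormedModType R)
    (B : 'Hom(E, 'Hom(E, R^o))) (f : E -> R^o) (psi : E -> \bar R)
    (p : nat) (H beta : R) (x v y T : nat -> E) (g : nat -> 'Hom(E, R^o))
    (Psi : nat -> E -> \bar R) : Prop := {
  run_x0 : edom psi (x 0%N);
  run_Psi0 : forall z, Psi 0%N z = (dprox p (z - x 0%N))%:E;
  run_v : forall k, argmin_on setT (Psi k) (v k);
  run_y : forall k, y k =
    (A_coef p H beta k / A_coef p H beta k.+1) *: x k
    + (a_coef p H beta k / A_coef p H beta k.+1) *: v k;
  run_T : forall k, acceptable B f psi p H (y k) beta (T k, g k);
  run_x : forall k, edom psi (x k.+1)
    /\ (composite f psi (x k.+1) <= composite f psi (T k))%E;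
  run_Psi : forall k z, Psi k.+1 z =
    (Psi k z + (a_coef p H beta k)%:E *
       ((f (T k) + grad f (T k) (z - T k))%R%:E + psi z))%E
}.

(* Main.v *)
Require Import Defs.
From mathcomp Require Import all_boot all_order all_algebra.
From mathcomp Require Import all_classical all_reals all_analysis.
From mathcomp Require Import ring lra.
Set Implicit Arguments.
Unset Strict Implicit.
Unset Printing Implicit Defensive.
Import Order.TTheory GRing.Theory Num.Theory.
Import numFieldNormedType.Exports.
Local Open Scope classical_set_scope.
Local Open Scope ring_scope.

(** The proof is Nesterov's method of estimating sequences, with p written
    n + 1 throughout.

    On dom psi the function Psi_k is d(z - x_0) plus a linear model of A_k f
    plus A_k psi. The model lies below A_k f by convexity
    ([linear_model_le]), so Psi_k <= A_k F + d(z - x_0). In the other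
    direction, d = d_{p+1} is uniformly convex of degree p + 1 with modulus
    2^(1-p) ([dprox_uniform]), and adding a convex function keeps the modulus,
    so Psi_k(z) >= Psi_k(v_k) + 2^(1-p) d(z - v_k) ([argmin_growth]). If
    moreover A_k F(x_k) <= Psi_k(v_k) ([estimate_lower], which is part (i)),
    comparing the two bounds at z = x^* gives
      A_k (F(x_k) - F^* ) + 2^(1-p) d(v_k - x^* ) <= d(x_0 - x^* )
    ([optimality_gap]). Both summands on the left are nonnegative: dropping
    the second gives (ii), dropping the first gives (iii).

    Part (i) is an induction on k. Writing G = grad f(T_k) + g_k, the
    subgradient inequalities at T_k and the growth of Psi_k around v_k reduce
    the step to
      0 <= A_(k+1) <G, y_k - T_k> + a_(k+1) <G, u - v_k> + 2^(1-p) d(u - v_k),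
    u being the new minimizer. The acceptance test bounds <G, y_k - T_k> below
    by |G| t, where H t^p = (1 - beta) |G| ([prox_step]); this is where
    beta <= 1/p enters. Cauchy-Schwarz bounds the second term, and what
    remains is a scalar inequality that the choice of A_k makes true by the
    weighted arithmetic-geometric mean inequality ([coef_estimate]).

    Two analytic facts need care. The uniform convexity of d is the integral
    along a segment of the strong monotonicity of its gradient |x|^(p-1) B x;
    the integral is replaced by a telescoping sum over equal steps, followed
    by a limit in the number of steps. The gradient of d itself, which the
    acceptance test refers to, is obtained from the convexity of d and the
    continuity of |x|^(p-1) x. *)

(** * Inequalities between powers *)

Lemma chebyshev_expr (R : realDomainType) (m n : nat) (a b : R) :
  0 <= a -> 0 <= b -> 0 <= (a ^+ m - b ^+ m) * (a ^+ n - b ^+ n).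
Proof.
move=> a0 b0; have [ab|/ltW ba] := leP a b.
  by rewrite mulr_le0// subr_le0 lerXn2r.
by rewrite mulr_ge0// subr_ge0 lerXn2r.
Qed.

(** The weighted arithmetic-geometric mean inequality for the weights
    n/(n+1) and 1/(n+1), free of roots. The two sides at n + 1 differ by z times
    their difference at n plus (z^(n+1) - s^(n+1)) (z - s). *)
Lemma young_expr (R : realDomainType) (n : nat) (z s : R) :
  0 <= z -> 0 <= s ->
  n.+1%:R * z ^+ n * s <= n%:R * z ^+ n.+1 + s ^+ n.+1.
Proof.
move=> z0 s0; elim: n => [|n IHn]; first by rewrite expr0 expr1; lra.
have := chebyshev_expr n.+1 1 z0 s0; have := ler_wpM2l z0 IHn.
rewrite !exprS -!natr1.
move: (z ^+ n) (s ^+ n) (n%:R : R) => Z S N; nra.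
Qed.

(** Convexity of the n-th power at the midpoint of a and b, in a
    division-free form that also covers n = 0. *)
Lemma exprD_power_mean (R : realDomainType) (n : nat) (a b : R) :
  0 <= a -> 0 <= b -> 2 * (a + b) ^+ n <= 2 ^+ n * (a ^+ n + b ^+ n).
Proof.
move=> a0 b0; elim: n => [|n IHn]; first by rewrite !expr0; lra.
have ab0 : 0 <= a + b by rewrite addr_ge0.
have := ler_wpM2l ab0 IHn.
have := mulr_ge0 (exprn_ge0 n (ler0n R 2)) (chebyshev_expr n 1 a0 b0).
rewrite !exprS.
move: (a ^+ n) (b ^+ n) ((a + b) ^+ n) (2 ^+ n : R) => x y u w; nra.
Qed.

Lemma expr_tangent (R : realDomainType) (n : nat) (a b : R) :
  0 <= a -> 0 <= b -> b ^+ n.+1 - a ^+ n.+1 <= n.+1%:R * b ^+ n * (b - a).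
Proof.
move=> a0 b0; have := young_expr n b0 a0; rewrite !exprS -natr1.
move: (b ^+ n) => z; lra.
Qed.

(** The weighted arithmetic-geometric mean inequality with weights n and n + 2
    for s^(2n+2) and t^(2n+2): apply [young_expr] to st and t^2, then bound
    (st)^(n+1) by the half-sum of squares. The case beta = 1/(n+1) of the
    acceptance test reduces to exactly this inequality. *)
Lemma prox_young (R : realDomainType) (n : nat) (s t : R) :
  0 <= s -> 0 <= t ->
  2 * n.+1%:R * (s ^+ n * t ^+ n.+2)
    <= n.+2%:R * t ^+ (n.+1).*2 + n%:R * s ^+ (n.+1).*2.
Proof.
move=> s0 t0.
have := young_expr n (mulr_ge0 s0 t0) (exprn_ge0 2 t0).
have sq : 0 <= (s ^+ n.+1 - t ^+ n.+1) ^+ 2 by rewrite sqr_ge0.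
have n0 : 0 <= n%:R :> R by rewrite ler0n.
have := mulr_ge0 n0 sq.
rewrite exprAC -muln2 !exprM !exprMn -!natr1 !exprS !expr0.
move: (s ^+ n) (t ^+ n) (n%:R : R) n0 => S T N n0; nra.
Qed.

(** The form in which every limit below is taken: the factor tends to 1. *)
Lemma ge_of_ge_exprM (R : realType) (n : nat) (X Y : R) :
  (forall m : nat, (1 - m.+2%:R^-1) ^+ n * Y <= X) -> Y <= X.
Proof.
move=> h; suff: (1 - m.+2%:R^-1) ^+ n * Y @[m --> \oo] --> Y.
  by move=> c; have := cvgr_to_le c; apply; exact: nearW.
rewrite [X in _ --> X](_ : Y = (1 - 0) ^+ n * Y); last first.
  by rewrite subr0 expr1n mul1r.
apply: cvgMr_tmp.
apply: (@continuous_cvg _ _ _ _ _ _ (fun x : R => x ^+ n)).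
  exact: exprn_continuous.
apply: cvgB; first exact: cvg_cst.
by rewrite (cvg_shiftS (fun m => m.+1%:R^-1 : R)); exact: cvg_harmonic.
Qed.

(** * The Euclidean norm and the uniform convexity of the prox-function *)

(** The pairing <Bx, y>, with its value read in the field R instead of the
    R-module R^o, so that it mixes with norms and scalars. *)
Definition inner (R : realType) (E : finDimNormedModType R)
  (B : 'Hom(E, 'Hom(E, R^o))) (x y : E) : R := B x y.

Section EuclideanGeometry.
Context (R : realType) (E : finDimNormedModType R).
Context (B : 'Hom(E, 'Hom(E, R^o))).
Context (B_self_adjoint : self_adjoint B) (B_pos_def : positive_definite B).
Context (normE : norm_induced_by B).

Local Notation "<< x , y >>" := (inner B x y) (format "<< x ,  y >>").

Lemma innerC (x y : E) : <<x, y>> = <<y, x>>.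
Proof. exact: B_self_adjoint. Qed.

Lemma innerDr (x y z : E) : <<x, y + z>> = <<x, y>> + <<x, z>>.
Proof. by rewrite /inner linearD. Qed.

Lemma innerNr (x y : E) : <<x, - y>> = - <<x, y>>.
Proof. by rewrite /inner linearN. Qed.

Lemma innerBr (x y z : E) : <<x, y - z>> = <<x, y>> - <<x, z>>.
Proof. by rewrite innerDr innerNr. Qed.

Lemma innerZr (a : R) (x y : E) : <<x, a *: y>> = a * <<x, y>>.
Proof. by rewrite /inner linearZ. Qed.

Lemma innerDl (x y z : E) : <<x + y, z>> = <<x, z>> + <<y, z>>.
Proof. by rewrite !(innerC _ z) innerDr. Qed.

Lemma innerBl (x y z : E) : <<x - y, z>> = <<x, z>> - <<y, z>>.
Proof. by rewrite !(innerC _ z) innerBr. Qed.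

Lemma innerZl (a : R) (x y : E) : <<a *: x, y>> = a * <<x, y>>.
Proof. by rewrite !(innerC _ y) innerZr. Qed.

Lemma innerxx (x : E) : <<x, x>> = `|x| ^+ 2.
Proof.
rewrite normE sqr_sqrtr//; have [->|x0] := eqVneq x 0.
  by rewrite linear0.
exact/ltW/B_pos_def.
Qed.

Lemma sqr_normD (x y : E) :
  `|x + y| ^+ 2 = `|x| ^+ 2 + 2 * <<x, y>> + `|y| ^+ 2.
Proof. by rewrite -!innerxx innerDl !innerDr (innerC y x); lra. Qed.

Lemma sqr_normB (x y : E) :
  `|x - y| ^+ 2 = `|x| ^+ 2 - 2 * <<x, y>> + `|y| ^+ 2.
Proof. by rewrite -!innerxx innerBl !innerBr (innerC y x); lra. Qed.

(** Cauchy-Schwarz. Since the norm is that of a normed space, its triangle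
    inequality, squared and expanded, gives the bound. *)
Lemma inner_le_norm (x y : E) : <<x, y>> <= `|x| * `|y|.
Proof.
have : `|x + y| ^+ 2 <= (`|x| + `|y|) ^+ 2.
  by rewrite lerXn2r ?nnegrE ?addr_ge0// ler_normD.
rewrite sqr_normD; nra.
Qed.

Lemma norm_inner_le (x y : E) : `|<<x, y>>| <= `|x| * `|y|.
Proof.
rewrite ler_norml inner_le_norm andbT.
by have := inner_le_norm x (- y); rewrite innerNr normrN; lra.
Qed.

Lemma dproxK (p : nat) (x : E) : p.+1%:R * dprox p x = `|x| ^+ p.+1.
Proof. by rewrite /dprox mulrA mulfV ?mul1r// gt_eqF// ltr0n. Qed.

(** By Cauchy-Schwarz and [young_expr], |x|^n <Bx, _> is a subgradient of
    d_{n+2} at x. That it is also the gradient is deduced from this in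
    [diff_dprox]. *)
Lemma dprox_tangent (n : nat) (x y : E) :
  dprox n.+1 x + `|x| ^+ n * <<x, y - x>> <= dprox n.+1 y.
Proof.
rewrite innerBr innerxx.
have cs : `|x| ^+ n * <<x, y>> <= `|x| ^+ n * (`|x| * `|y|).
  by rewrite ler_wpM2l ?exprn_ge0// inner_le_norm.
have n0 : 0 < n.+2%:R :> R by rewrite ltr0n.
have Y := young_expr n.+1 (normr_ge0 x) (normr_ge0 y).
rewrite -(ler_pM2l n0) mulrDr !dproxK.
have := ler_wpM2l (ltW n0) cs.
move: Y; rewrite !exprS -!natr1 expr0.
move: (`|x| ^+ n) (`|y| ^+ n) (n%:R : R) (`|x|) (`|y|) <<x, y>> => X Z N a b c.
lra.
Qed.

(** Strong monotonicity of the gradient of d_{n+2}. With a = |x| and b = |y|,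
    the pairing on the right is half of
    (a^n + b^n) |x - y|^2 + (a^n - b^n) (a^2 - b^2); the last product is
    nonnegative and |x - y|^n <= (a + b)^n <= 2^(n-1) (a^n + b^n). *)
Lemma dprox_monotone (n : nat) (x y : E) :
  `|x - y| ^+ n.+2 <=
    2 ^+ n * (`|x| ^+ n * <<x, x - y>> - `|y| ^+ n * <<y, x - y>>).
Proof.
have pm : 2 * `|x - y| ^+ n <= 2 ^+ n * (`|x| ^+ n + `|y| ^+ n).
  apply: le_trans (exprD_power_mean n (normr_ge0 x) (normr_ge0 y)).
  by rewrite ler_wpM2l// lerXn2r ?nnegrE ?addr_ge0// ler_normB.
have := mulr_ge0 (exprn_ge0 n (ler0n R 2))
  (chebyshev_expr n 2 (normr_ge0 x) (normr_ge0 y)).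
have := ler_wpM2r (sqr_ge0 `|x - y|) pm.
rewrite -[n.+2]addn2 exprD.
rewrite (innerBr x) (innerBr y) !innerxx (innerC y x).
have := sqr_normB x y.
move: (`|x| ^+ n) (`|y| ^+ n) (`|x - y| ^+ n) (`|x - y| ^+ 2) => a b d D.
move: (`|x| ^+ 2) (`|y| ^+ 2) (2 ^+ n : R) <<x, y>> => u v w c ->.
lra.
Qed.

Lemma dproxZ (p : nat) (a : R) (x : E) : 0 <= a ->
  dprox p (a *: x) = a ^+ p.+1 * dprox p x.
Proof. by move=> a0; rewrite /dprox normrZ ger0_norm// exprMn mulrCA. Qed.

Lemma dprox_ge0 (p : nat) (x : E) : 0 <= dprox p x.
Proof. by rewrite mulr_ge0 ?exprn_ge0. Qed.

(** A discrete version of integrating [dprox_monotone] along a ray: at each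
    step of length u the tangent inequality is applied at the current point
    x + ku, where the slope exceeds the slope at x by a multiple of k^(n+1).
    The accumulated gain is a lower Riemann sum of the integral of
    (n+2) s^(n+1) over [0, k]; it dominates (k-1)^(n+2) by [expr_tangent]. *)
Lemma dprox_steps (n k : nat) (x u : E) :
  dprox n.+1 x + k%:R * (`|x| ^+ n * <<x, u>>)
    + k.-1%:R ^+ n.+2 * ((2 ^+ n)^-1 * dprox n.+1 u)
  <= dprox n.+1 (x + k%:R *: u).
Proof.
elim: k => [|k IHk]; first by rewrite scale0r addr0 expr0n/= !mul0r !addr0.
have := dprox_tangent n (x + k%:R *: u) (x + k.+1%:R *: u).
rewrite -natr1 scalerDl scale1r addrA [X in <<_, X>>]addrAC subrr add0r.
apply: le_trans.
set z := x + k%:R *: u in IHk *.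
have w0 : 0 < 2 ^+ n :> R by rewrite exprn_gt0.
(* Monotonicity is tested against z - x = k u, so a factor k has to be divided
   out; at k = 0 both sides vanish. *)
have mono : k%:R ^+ n.+1 * ((2 ^+ n)^-1 * `|u| ^+ n.+2)
    <= `|z| ^+ n * <<z, u>> - `|x| ^+ n * <<x, u>>.
  case: k @z {IHk} => [|k] z; first by rewrite /z scale0r addr0 expr0n/= mul0r subrr.
  have := dprox_monotone n z x.
  have -> : z - x = k.+1%:R *: u by rewrite /z addrC addKr.
  rewrite normrZ ger0_norm// exprMn !innerZr => mono.
  rewrite -(ler_pM2l (_ : 0 < k.+1%:R * 2 ^+ n :> R)) ?mulr_gt0//.
  have -> : k.+1%:R * 2 ^+ n * (k.+1%:R ^+ n.+1 * ((2 ^+ n)^-1 * `|u| ^+ n.+2))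
      = k.+1%:R ^+ n.+2 * `|u| ^+ n.+2 :> R.
    by rewrite [k.+1%:R ^+ n.+2]exprS; field; rewrite gt_eqF.
  lra.
have c0 : 0 <= (2 ^+ n)^-1 * dprox n.+1 u :> R.
  by rewrite mulr_ge0 ?dprox_ge0// invr_ge0 ltW.
rewrite -dproxK in mono.
have tangent : (k%:R ^+ n.+2 - k.-1%:R ^+ n.+2) * ((2 ^+ n)^-1 * dprox n.+1 u)
    <= n.+2%:R * k%:R ^+ n.+1 * ((2 ^+ n)^-1 * dprox n.+1 u) :> R.
  rewrite ler_wpM2r//; case: (k) => [|j].
    by rewrite /= subrr mulr_ge0// exprn_ge0.
  have := expr_tangent n.+1 (ler0n R j) (ler0n R j.+1).
  have -> : j.+1%:R - j%:R = 1 :> R by rewrite -natr1; ring.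
  by rewrite mulr1.
move: IHk mono tangent; rewrite /=; move: (k%:R ^+ n.+2) (k.-1%:R ^+ n.+2) (k%:R ^+ n.+1) ((2 ^+ n)^-1) => a b c w.
nra.
Qed.

(** Uniform convexity of degree n + 2 with modulus 2^-n: take [dprox_steps]
    with m + 2 steps of length h/(m+2) and let m tend to infinity. *)
Lemma dprox_uniform (n : nat) (x h : E) :
  dprox n.+1 x + `|x| ^+ n * <<x, h>> + (2 ^+ n)^-1 * dprox n.+1 h
  <= dprox n.+1 (x + h).
Proof.
rewrite -lerBrDl; apply: (@ge_of_ge_exprM _ n.+2) => m.
have m0 : m.+2%:R != 0 :> R by rewrite gt_eqF// ltr0n.
have := dprox_steps n m.+2 x (m.+2%:R^-1 *: h).
rewrite scalerA mulfV// scale1r dproxZ// innerZr /=.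
have -> : 1 - m.+2%:R^-1 = m.+1%:R * m.+2%:R^-1 :> R.
  by rewrite -[m.+2%:R]natr1 in m0 *; field.
rewrite exprMn; move: (dprox n.+1 h) (dprox n.+1 x) => dh dx.
have -> : m.+2%:R * (`|x| ^+ n * (m.+2%:R^-1 * <<x, h>>)) = `|x| ^+ n * <<x, h>>.
  by rewrite mulrCA [X in _ * X]mulrA mulfV// mul1r.
lra.
Qed.

End EuclideanGeometry.

(** * Gradients *)

Section Differentials.
Context (R : realType) (E : finDimNormedModType R).
Context (B : 'Hom(E, 'Hom(E, R^o))).
Context (B_self_adjoint : self_adjoint B) (B_pos_def : positive_definite B).
Context (normE : norm_induced_by B).
Local Notation "<< x , y >>" := (inner B x y) (format "<< x ,  y >>").

Lemma lfun_inner_continuous (x : E) : continuous (B x).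
Proof.
apply/linear_bounded_continuous.
apply/linear_boundedP.
near=> r => y.
apply: le_trans (norm_inner_le B_self_adjoint B_pos_def normE x y) _.
rewrite ler_wpM2r//.
Unshelve. all: by end_near. Qed.

(** The first-order remainder of d at w is nonnegative by the tangent
    inequality at w, and at most <G(w+h) - G(w), h> by the tangent inequality
    at w + h, where G(z) = |z|^n z. Continuity of G makes it o(h). *)
Lemma dprox_littleo (n : nat) (c x : E) :
  (fun z : E => dprox n.+1 (z - c) : R^o) \o shift x =
    cst (dprox n.+1 (x - c) : R^o)
    + (`|x - c| ^+ n *: B (x - c) : 'Hom(E, R^o)) +o_ (0 : E) id.
Proof.
apply/eqaddoP => e e0.
set w := x - c; pose G z : E := `|z| ^+ n *: z.
have Gc : G (h + w) @[h --> (0 : E)] --> G w.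
  have hw : h + w @[h --> (0 : E)] --> w.
    rewrite -[X in _ --> X]add0r; apply: cvgD; [exact: cvg_id | exact: cvg_cst].
  apply: cvgZ => //.
  apply: (@continuous_cvg _ _ _ _ _ _ (fun a : R => a ^+ n)).
    exact: exprn_continuous.
  exact: cvg_norm.
have innerG z u : <<G z, u>> = `|z| ^+ n * <<z, u>> by rewrite innerZl.
move/cvgrPdist_le : Gc => /(_ e e0); apply: filterS => h Gh.
have -> : ((fun z : E => dprox n.+1 (z - c) : R^o) \o shift x
  - (cst (dprox n.+1 (x - c) : R^o)
     + (`|x - c| ^+ n *: B (x - c) : 'Hom(E, R^o)))) h
  = dprox n.+1 (h + w) - dprox n.+1 w - <<G w, h>>.
  rewrite innerG /w /= !fctE /= scale_lfunE opprD addrA.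
  by rewrite -[h + x - c]addrA.
have lo := dprox_tangent B_self_adjoint B_pos_def normE n w (h + w).
have hi := dprox_tangent B_self_adjoint B_pos_def normE n (h + w) w.
have hw : w - (h + w) = - h by rewrite opprD addrCA subrr addr0.
rewrite addrK -innerG in lo; rewrite hw innerNr mulrN -innerG in hi.
rewrite ger0_norm; last by lra.
apply: le_trans (_ : <<G (h + w) - G w, h>> <= _); first by rewrite innerBl//; lra.
apply: le_trans (inner_le_norm B_self_adjoint B_pos_def normE _ _) _.
by rewrite ler_wpM2r// distrC.
Qed.

Lemma diff_dprox (n : nat) (c x : E) :
  'd (fun z : E => dprox n.+1 (z - c) : R^o) x
  = (`|x - c| ^+ n *: B (x - c) : 'Hom(E, R^o)) :> (E -> R^o).
Proof.
apply: diff_unique; last exact: dprox_littleo.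
rewrite -linearZ; exact: lfun_inner_continuous.
Qed.

Lemma differentiable_dprox (n : nat) (c x : E) :
  differentiable (fun z : E => dprox n.+1 (z - c) : R^o) x.
Proof.
apply/diff_locallyP; rewrite diff_dprox; split; last exact: dprox_littleo.
rewrite -linearZ; exact: lfun_inner_continuous.
Qed.

Lemma grad_prox_objective (f : E -> R^o) (n : nat) (H : R) (c x : E) :
  differentiable f x ->
  grad (prox_objective f n.+1 H c) x
  = grad f x + B ((H * `|x - c| ^+ n) *: (x - c)).
Proof.
move=> df; apply/lfunP => u.
rewrite add_lfunE /grad !lfunE /=.
have -> : prox_objective f n.+1 H c
  = f + H *: (fun z : E => dprox n.+1 (z - c) : R^o) by apply/funext.
rewrite diffD//; last exact/differentiableZ/differentiable_dprox.
rewrite /= diffZ/=; last exact: differentiable_dprox.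
by rewrite diff_dprox linearZ/= !scale_lfunE scalerA.
Qed.

(** The difference quotients of f along y - x are bounded by f y - f x for
    steps in (0, 1], hence so is their limit from the right. *)
Lemma convex_tangent (f : E -> R^o) (x y : E) :
  @convex_function R E setT f -> differentiable f x ->
  f x + grad f x (y - x) <= f y.
Proof.
move=> fconv df; rewrite /grad lfunE /= -deriveE// -lerBrDl.
have /cvg_dnbhs_at_right D := diff_derivable (v := y - x) df.
apply: (cvgr_to_le D); near=> t.
have t0 : 0 < t by near: t; exact: nbhs_right_gt.
have t1 : t <= 1 by near: t; exact: nbhs_right_le.
have := fconv (Itv01 (ltW t0) t1) y x (in_setT _) (in_setT _).
rewrite convRE /conv/= => cv.
have pointE : t *: (y - x) + x = t *: y + (1 - t) *: x.
  by rewrite scalerBr scalerBl scale1r -addrA (addrC (- _)).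
rewrite pointE -[X in X <= _]/(t^-1 * (f (t *: y + (1 - t) *: x) - f x)).
rewrite ler_pdivrMl// lerBlDr; apply: le_trans cv _.
rewrite /unstable.onem; move: (f y : R) (f x : R) => a b; lra.
Unshelve. all: by end_near. Qed.
End Differentials.

(** * The inexact proximal step *)

Section ProxStep.
Context (R : realType) (E : finDimNormedModType R).
Context (B : 'Hom(E, 'Hom(E, R^o))).
Context (B_self_adjoint : self_adjoint B) (B_pos_def : positive_definite B).
Context (normE : norm_induced_by B).
Local Notation "<< x , y >>" := (inner B x y) (format "<< x ,  y >>").

(** Injectivity of B, together with the equality of the dimensions of the space
    and its dual, makes B^-1 a two-sided inverse; the dual norm of a functional
    is then the norm of its preimage. *)
Lemma lker_riesz : lker B == 0%VS.
Proof.
rewrite -subv0; apply/subvP => x; rewrite memv_ker memv0 => /eqP Bx0.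
by apply/contraT => /B_pos_def; rewrite Bx0 zero_lfunE ltxx.
Qed.

Lemma rieszK : cancel B B^-1%VF.
Proof. exact: lker0_lfunK lker_riesz. Qed.

Lemma rieszVK : cancel B^-1%VF B.
Proof.
move=> g; apply: limg_lfunVK; suff -> : (limg B = fullv)%VS by rewrite memvf.
apply/eqP; rewrite eqEdim subvf limg_dim_eq ?(eqP lker_riesz) ?capv0//.
by rewrite !dimvf andTb -[leqRHS]muln1; exact: leqnn.
Qed.

Lemma dual_normE (g : 'Hom(E, R^o)) : dual_norm B g = `|B^-1%VF g|.
Proof. by rewrite normE /dual_norm rieszVK. Qed.

(** With w = B^-1 G and z = T - y, the acceptance test becomes a bound on
    |w + H |z|^n z|. The triangle inequality turns it into |z| >= t, and
    squaring it gives
      - 2 H |z|^n <w, z> >= (1 - beta^2) |w|^2 + H^2 |z|^(2n+2).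
    After eliminating |w| through t, it remains to see that
    (1 + beta) t^(2n+2) + (1 - beta) |z|^(2n+2) >= 2 |z|^n t^(n+2). Since
    |z| >= t the left side decreases in beta, so the worst case is
    beta = 1/(n+1), which is [prox_young]. *)
Lemma prox_step (n : nat) (H beta t : R) (w z : E) :
  0 < H -> 0 <= beta -> beta <= 1 / n.+1%:R -> beta < 1 -> 0 <= t ->
  H * t ^+ n.+1 = (1 - beta) * `|w| ->
  `|w + (H * `|z| ^+ n) *: z| <= beta * `|w| ->
  `|w| * t <= - <<w, z>>.
Proof.
move=> H0 b0 bn b1 t0 tE acc.
have s0 := normr_ge0 z; have g0 := normr_ge0 w.
have hs : 0 <= H * `|z| ^+ n by rewrite mulr_ge0 ?exprn_ge0 ?(ltW H0).
have nz : `|(H * `|z| ^+ n) *: z| = H * `|z| ^+ n.+1.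
  by rewrite normrZ ger0_norm// exprSr mulrA.
have ts : t <= `|z|.
  have := ler_normB (w + (H * `|z| ^+ n) *: z) ((H * `|z| ^+ n) *: z).
  rewrite addrK nz => tri; rewrite -(@ler_pXn2r R n.+1)// ?nnegrE//.
  by rewrite -(ler_pM2l H0) tE; lra.
have [z0|/eqP zn0] := eqVneq z 0.
  have -> : t = 0.
    by apply/eqP; rewrite eq_le t0 andbT; move: ts; rewrite z0 normr0.
  by rewrite mulr0 z0 -(scale0r (0 : E)) innerZr// mul0r oppr0.
have sp : 0 < `|z| by rewrite normr_gt0; apply/eqP.
have d0 : 0 < 1 - beta by rewrite subr_gt0.
have sq : `|w| ^+ 2 + 2 * (H * `|z| ^+ n * <<w, z>>) + (H * `|z| ^+ n.+1) ^+ 2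
    <= (beta * `|w|) ^+ 2.
  by rewrite -nz -innerZr// -sqr_normD// lerXn2r ?nnegrE ?mulr_ge0.
have key : 2 * (`|z| ^+ n * t ^+ n.+2) <=
    (1 + beta) * t ^+ n.+1 ^+ 2 + (1 - beta) * `|z| ^+ n.+1 ^+ 2.
  have := prox_young n s0 t0; rewrite -muln2 !exprM.
  have : t ^+ n.+1 ^+ 2 <= `|z| ^+ n.+1 ^+ 2 by rewrite !lerXn2r ?nnegrE ?exprn_ge0.
  have : beta * n.+1%:R <= 1 by move: bn; rewrite ler_pdivlMr ?ltr0n.
  have : 0 < n.+1%:R :> R by rewrite ltr0n.
  have -> : n.+2%:R = n.+1%:R + 1 :> R by rewrite natr1.
  have -> : n%:R = n.+1%:R - 1 :> R by rewrite -natr1 addrK.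
  move: (n.+1%:R : R) (t ^+ n.+1 ^+ 2) (`|z| ^+ n.+1 ^+ 2) (`|z| ^+ n * t ^+ n.+2).
  move=> N T S V N0 bN TS young; rewrite -(ler_pM2l N0).
  have := mulr_ge0 (_ : 0 <= 1 - beta * N) (_ : 0 <= S - T).
  by rewrite !subr_ge0 => /(_ bN TS); lra.
have pos : 0 < 2 * H * `|z| ^+ n * (1 - beta) by rewrite !mulr_gt0 ?exprn_gt0.
rewrite -(ler_pM2l pos).
have H2 := ler_wpM2l (exprn_ge0 2 (ltW H0)) key.
have E1 : 2 * H * `|z| ^+ n * (1 - beta) * (`|w| * t)
    = H ^+ 2 * (2 * (`|z| ^+ n * t ^+ n.+2)).
  transitivity (2 * H * `|z| ^+ n * t * (H * t ^+ n.+1)); first by rewrite tE; ring.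
  by rewrite [t ^+ n.+2]exprS; ring.
have E2 : H ^+ 2 * t ^+ n.+1 ^+ 2 = (1 - beta) ^+ 2 * `|w| ^+ 2.
  by rewrite -!exprMn tE.
rewrite E1; apply: le_trans H2 _; rewrite mulrDr mulrCA E2.
have := ler_wpM2l (ltW d0) sq; rewrite !exprMn.
move: (`|z| ^+ n) (`|z| ^+ n.+1) (`|w|) <<w, z>> => Z Z1 W c.
nra.
Qed.
End ProxStep.

(** * Growth around a minimizer and the coefficients *)

(** Minimality of v is used only along the segment towards x. At the point z
    with parameter t, uniform convexity bounds d(x - x0) and the tangent
    inequality bounds d(v - x0); combining them with weights t and 1 - t
    cancels the linear terms. Dividing by t and letting t tend to 0 recovers
    the full modulus, whereas the midpoint alone would lose a constant. *)
Lemma argmin_growth (R : realType) (E : finDimNormedModType R)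
    (B : 'Hom(E, 'Hom(E, R^o))) (B_self_adjoint : self_adjoint B)
    (B_pos_def : positive_definite B) (normE : norm_induced_by B)
    (n : nat) (phi : E -> R) (x0 v x : E) :
  (forall t : R, 0 <= t <= 1 ->
     phi (t *: x + (1 - t) *: v) <= t * phi x + (1 - t) * phi v) ->
  (forall t : R, 0 <= t <= 1 -> let z := t *: x + (1 - t) *: v in
     dprox n.+1 (v - x0) + phi v <= dprox n.+1 (z - x0) + phi z) ->
  dprox n.+1 (v - x0) + phi v + (2 ^+ n)^-1 * dprox n.+1 (x - v)
  <= dprox n.+1 (x - x0) + phi x.
Proof.
move=> conv opt; rewrite -lerBrDl; apply: (@ge_of_ge_exprM _ n.+2) => m.
set t := m.+2%:R^-1.
have t0 : 0 < t by rewrite invr_gt0 ltr0n.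
have t1 : t <= 1 by rewrite invf_le1 ?ler1n ?ltr0n.
have t01 : 0 <= t <= 1 by rewrite ltW.
have := opt t t01; have := conv t t01 => /=.
set z := t *: x + (1 - t) *: v => cz oz.
have s0 : 0 <= 1 - t by rewrite subr_ge0.
have xE : x - x0 = (z - x0) + (1 - t) *: (x - v).
  rewrite /z [RHS]addrAC; congr (_ - _).
  rewrite scalerBr addrA addrAC addrK -scalerDl.
  have -> : t + (1 - t) = 1 by ring.
  by rewrite scale1r.
have vE : v - x0 - (z - x0) = - (t *: (x - v)).
  rewrite opprB addrA subrK /z scalerBl scale1r scalerBr opprD !opprB.
  by rewrite addrA (addrC v) -addrA [v + _]addrCA subrr addr0 addrC.
have up := dprox_uniform B_self_adjoint B_pos_def normE n (z - x0) ((1 - t) *: (x - v)).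
have lo := dprox_tangent B_self_adjoint B_pos_def normE n (z - x0) (v - x0).
rewrite -xE dproxZ// innerZr in up; rewrite vE innerNr innerZr in lo.
rewrite -(ler_pM2l t0).
move: oz cz (ler_wpM2l (ltW t0) up) (ler_wpM2l s0 lo).
move: (2 ^- n) ((1 - t) ^+ n.+2) (inner B _ _) (`|_| ^+ n) => a b c e.
move: (dprox n.+1 (v - x0)) (dprox n.+1 (x - x0)) (dprox n.+1 (z - x0)).
move: (dprox n.+1 (x - v)) => d D1 D2 D3.
lra.
Qed.

Lemma powR_invX (R : realType) (n : nat) (r : R) : 0 <= r ->
  (r `^ n.+1%:R^-1) ^+ n.+1 = r.
Proof.
by move=> r0; rewrite -powR_mulrn ?powR_ge0// -powRrM mulVf ?powRr1// pnatr_eq0.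
Qed.

Section CoefficientEstimates.
Context (R : realType) (n : nat) (H beta : R).
Context (H_gt0 : 0 < H) (beta_lt1 : beta < 1).

Local Notation c := (c_coef n.+1 H beta).
Local Notation A := (A_coef n.+1 H beta).
Local Notation a := (a_coef n.+1 H beta).

Lemma c_coef_gt0 : 0 < c.
Proof. by rewrite powR_gt0// divr_gt0// subr_gt0. Qed.

Lemma c_coefX : c ^+ n.+1 = (1 - beta) / H.
Proof. by rewrite powR_invX// divr_ge0 ?subr_ge0 ?ltW. Qed.

Lemma A_coef0 : A 0 = 0.
Proof. by rewrite /A_coef mul0r expr0n/= mulr0. Qed.

Lemma A_coef_gt0 k : (0 < k)%N -> 0 < A k.
Proof.
by move=> k0; rewrite mulr_gt0 ?exprn_gt0 ?divr_gt0 ?c_coef_gt0 ?ltr0n.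
Qed.

Lemma A_coef_ge0 k : 0 <= A k.
Proof. by case: k => [|k]; [rewrite A_coef0 | rewrite ltW ?A_coef_gt0]. Qed.

Lemma A_coefS k : A k.+1 = A k + a k.
Proof. by rewrite /a_coef addrC subrK. Qed.

Lemma a_coef_gt0 k : 0 < a k.
Proof.
rewrite subr_gt0 ltr_pM2l ?exprn_gt0 ?divr_gt0 ?c_coef_gt0//.
by rewrite ltr_pXn2r ?nnegrE ?divr_ge0// ltr_pM2r ?invr_gt0// ltr_nat.
Qed.

Lemma a_coef_le k : a k <= (c / 2 * (k.+1%:R / n.+2%:R)) ^+ n.+1.
Proof.
rewrite exprMn /a_coef -mulrBr ler_wpM2l ?exprn_ge0 ?divr_ge0 ?(ltW c_coef_gt0)//.
have N0 : 0 < n.+2%:R :> R by rewrite ltr0n.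
have q0 j : 0 <= j%:R / n.+2%:R :> R by rewrite divr_ge0.
have := expr_tangent n.+1 (q0 k) (q0 k.+1); rewrite -mulrBl.
have -> : k.+1%:R - k%:R = 1 :> R by rewrite -natr1 addrC addKr.
by rewrite mul1r -mulrA mulrCA mulfV ?gt_eqF// mulr1.
Qed.

(** The scalar inequality behind the choice of A_k. Put c = c_p,
    m = (k+1)/(n+2) and z = mt/2. Since c^(n+1) w = t^(n+1), the first term
    equals 2 z^(n+2), the second is at most z^(n+1) s, and the claim
    follows from [young_expr] applied to z and s/2. *)
Lemma coef_estimate k (w s t : R) :
  0 <= w -> 0 <= s -> 0 <= t -> H * t ^+ n.+1 = (1 - beta) * w ->
  0 <= A k.+1 * (w * t) - a k * (w * s)
       + (2 ^+ n)^-1 * (n.+2%:R^-1 * s ^+ n.+2).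
Proof.
move=> w0 s0 t0 tE.
have c0 := c_coef_gt0.
have ct : c ^+ n.+1 * w = t ^+ n.+1.
  by rewrite c_coefX mulrAC -tE mulrAC mulfV ?mul1r// gt_eqF.
pose m : R := k.+1%:R / n.+2%:R; pose z := m * t / 2.
have m0 : 0 <= m by rewrite divr_ge0.
have z0 : 0 <= z by rewrite !mulr_ge0.
have Az : A k.+1 * (w * t) = 2 * z ^+ n.+2.
  rewrite /A_coef -/m /z [in RHS]exprMn [in RHS]exprMn [t ^+ n.+2]exprSr -ct.
  by rewrite !exprMn [2^-1 ^+ n.+2]exprS; field.
have az : a k * (w * s) <= z ^+ n.+1 * s.
  rewrite mulrA ler_wpM2r//; apply: le_trans (ler_wpM2r w0 (a_coef_le k)) _.
  by rewrite -/m /z !exprMn -ct; lra.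
have N0 : 0 < n.+2%:R :> R by rewrite ltr0n.
have s20 : 0 <= s / 2 by rewrite divr_ge0.
have Y := young_expr n.+1 z0 s20.
have sE : (2 ^+ n)^-1 * (n.+2%:R^-1 * s ^+ n.+2) = 4 * (n.+2%:R^-1 * (s / 2) ^+ n.+2).
  by rewrite exprMn exprVn !exprS; field; rewrite !gt_eqF// exprn_gt0.
rewrite Az sE -(ler_pM2l N0) mulr0.
move: az Y; rewrite -[n.+1%:R](addrK 1) natr1.
have NN : n.+2%:R * n.+2%:R^-1 = 1 :> R by rewrite mulfV ?gt_eqF.
rewrite !mulrDr mulrN [n.+2%:R * (4 * _)]mulrCA [n.+2%:R * (_ * (s / 2) ^+ _)]mulrA NN mul1r.
have zp : 0 <= z ^+ n.+2 by rewrite exprn_ge0.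
have sp : 0 <= (s / 2) ^+ n.+2 by rewrite exprn_ge0// divr_ge0.
move=> /(ler_wpM2l (ltW N0)).
move: zp sp; move: (z ^+ n.+2) ((s / 2) ^+ n.+2) (z ^+ n.+1) => Z S Q.
lra.
Qed.
End CoefficientEstimates.

(** * Real-valued calculus on the effective domain *)

Section EffectiveDomain.
Context (R : realType) (E : finDimNormedModType R) (psi : E -> \bar R).
Context (psi_proper : proper_efun psi).

Lemma edom_fineK z : edom psi z -> (fine (psi z))%:E = psi z.
Proof.
by move=> zD; apply: fineK; rewrite fin_numE psi_proper.1 lt_eqF.
Qed.

Lemma convex_efun_fine (t : R) x y : convex_efun psi -> 0 <= t <= 1 ->
  edom psi x -> edom psi y ->
  edom psi (t *: x + (1 - t) *: y) /\
  fine (psi (t *: x + (1 - t) *: y))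
    <= t * fine (psi x) + (1 - t) * fine (psi y).
Proof.
move=> cpsi t01 xD yD; have := cpsi t x y t01.
rewrite -(edom_fineK xD) -(edom_fineK yD) -!EFinM -EFinD => le.
have zD : edom psi (t *: x + (1 - t) *: y) by apply: le_lt_trans le (ltry _).
by split=> //; rewrite -lee_fin (edom_fineK zD); exact: le.
Qed.

Lemma subdifferential_fine x y (g : 'Hom(E, R^o)) :
  subdifferential psi x g -> edom psi x -> edom psi y ->
  fine (psi x) + g (y - x) <= fine (psi y).
Proof.
by move=> gx xD yD; rewrite -lee_fin EFinD !edom_fineK//; exact: gx.
Qed.

End EffectiveDomain.

(** * The estimating sequence *)

Section AcceleratedRun.
Context (R : realType) (E : finDimNormedModType R).
Context (B : 'Hom(E, 'Hom(E, R^o))).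
Context (B_self_adjoint : self_adjoint B) (B_pos_def : positive_definite B).
Context (normE : norm_induced_by B).
Context (f : E -> R^o) (f_convex : @convex_function R E setT f).
Context (f_diff : forall z : E, differentiable f z).
Context (psi : E -> \bar R) (psi_proper : proper_efun psi).
Context (psi_convex : convex_efun psi).
Context (n : nat) (H : R) (H_gt0 : 0 < H).
Context (beta : R) (beta_ge0 : 0 <= beta) (beta_le : beta <= 1 / n.+1%:R).
Context (beta_lt1 : beta < 1).
Context (x v y T : nat -> E) (g : nat -> 'Hom(E, R^o)) (Psi : nat -> E -> \bar R).
Context (run : accelerated_run B f psi n.+1 H beta x v y T g Psi).

Local Notation A := (A_coef n.+1 H beta).
Local Notation a := (a_coef n.+1 H beta).
Local Notation q z := (fine (psi z)).
Local Notation F z := ((f z : R) + q z).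
Local Notation d := (dprox n.+1).

Definition linear_model (k : nat) (z : E) : R :=
  \sum_(i < k) a i * (f (T i) + grad f (T i) (z - T i)).

(** The real-valued function that Psi_k restricts to on dom psi. *)
Definition estimate (k : nat) (z : E) : R :=
  d (z - x 0%N) + (linear_model k z + A k * q z).

Lemma linear_modelS k z : linear_model k.+1 z =
  linear_model k z + a k * (f (T k) + grad f (T k) (z - T k)).
Proof. by rewrite /linear_model big_ord_recr. Qed.

Lemma linear_model_affine k (t : R) z u :
  linear_model k (t *: z + (1 - t) *: u)
  = t * linear_model k z + (1 - t) * linear_model k u.
Proof.
elim: k => [|k IHk]; first by rewrite /linear_model !big_ord0 !mulr0 addr0.
rewrite !linear_modelS IHk.
have -> : t *: z + (1 - t) *: u - T k = t *: (z - T k) + (1 - t) *: (u - T k).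
  rewrite !scalerBr addrACA -opprD -scalerDl.
  by have -> : t + (1 - t) = 1 by [ring]; rewrite scale1r.
rewrite linearD !linearZ /=.
rewrite -[_ *: _]/(t * _) -[(1 - t) *: _]/((1 - t) * _).
move: (grad f (T k) _ : R) (grad f (T k) _ : R) (f (T k) : R) => b c e.
ring.
Qed.

Lemma estimateE k z : edom psi z -> Psi k z = (estimate k z)%:E.
Proof.
move=> zD; elim: k => [|k IHk].
  by rewrite run.(run_Psi0) /estimate /linear_model big_ord0 A_coef0// mul0r !addr0.
rewrite run.(run_Psi) IHk -(edom_fineK psi_proper zD) -!EFinD.
congr (_%:E); rewrite /estimate linear_modelS (A_coefS _ _ _ k).
by move: (f (T k) : R) (grad f (T k) _ : R) => b c; ring.
Qed.

(** Only from k + 1 on: Psi_0 does not involve psi and is finite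
    everywhere. *)
Lemma Psi_outside k z : ~ edom psi z -> Psi k.+1 z = +oo%E.
Proof.
move=> zD; have psiz : psi z = +oo%E by apply/eqP; rewrite -leye_eq leNgt; apply/negP.
suff Psi_gt k' : Psi k' z != -oo%E.
  by rewrite run.(run_Psi) psiz addey// gt0_muley ?lte_fin ?a_coef_gt0// addey.
elim: k' => [|k' IHk]; first by rewrite run.(run_Psi0).
by rewrite run.(run_Psi) psiz addey// gt0_muley ?lte_fin ?a_coef_gt0// addey.
Qed.

Lemma v0E : v 0%N = x 0%N.
Proof.
have [_ /(_ (x 0%N) I)] := run.(run_v) 0%N.
rewrite !run.(run_Psi0) lee_fin subrr /dprox normr0 expr0n mulr0.
rewrite pmulr_rle0 ?invr_gt0 ?ltr0n// => v0.
apply/eqP; rewrite -subr_eq0 -normr_eq0; apply/negPn/negP => nz.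
by move: v0; rewrite leNgt exprn_gt0// lt_def nz normr_ge0.
Qed.

(** For k > 0 the value of Psi_k at x_0 is finite, so its minimizer cannot lie
    outside dom psi; for k = 0 the minimizer is x_0 itself. *)
Lemma v_edom k : edom psi (v k).
Proof.
have x0D := run.(run_x0); case: k => [|k]; first by rewrite v0E.
apply: contrapT => /(Psi_outside k) vk.
have [_ /(_ (x 0%N) I)] := run.(run_v) k.+1.
by rewrite vk estimateE.
Qed.

Lemma x_edom k : edom psi (x k).
Proof. by case: k => [|k]; [exact: run.(run_x0) | exact: (run.(run_x) k).1]. Qed.

Lemma T_edom k : edom psi (T k).
Proof. by have [] := run.(run_T) k. Qed.

Lemma estimate_growth k z : edom psi z ->
  estimate k (v k) + (2 ^+ n)^-1 * d (z - v k) <= estimate k z.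
Proof.
move=> zD.
have vD := v_edom k.
apply: (argmin_growth B_self_adjoint B_pos_def normE
  (phi := fun u => linear_model k u + A k * q u)) => t t01.
  have [_ cq] := convex_efun_fine psi_proper psi_convex t01 zD vD.
  rewrite linear_model_affine.
  have := ler_wpM2l (A_coef_ge0 n H_gt0 beta_lt1 k) cq; lra.
have [uD _] := convex_efun_fine psi_proper psi_convex t01 zD vD.
have [_ /(_ _ I)] := run.(run_v) k.
by rewrite estimateE// => /(_ (t *: z + (1 - t) *: v k)); rewrite estimateE// lee_fin.
Qed.

Lemma linear_model_le k z : linear_model k z <= A k * f z.
Proof.
elim: k => [|k IHk].
  by rewrite /linear_model big_ord0 A_coef0 mul0r.
rewrite linear_modelS A_coefS [leRHS]mulrDl lerD//.
by rewrite ler_wpM2l ?(ltW (a_coef_gt0 n H_gt0 beta_lt1 k))// convex_tangent.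
Qed.

Lemma composite_descent k : F (x k.+1) <= F (T k).
Proof.
by have [xD le] := run.(run_x) k; rewrite -lee_fin !EFinD !edom_fineK//; exact: T_edom.
Qed.

(** The induction behind part (i). The definition of y_k is what makes the
    linear terms at x_k and at the new minimizer combine into terms at
    y_k - T_k and u - v_k. *)
Lemma estimate_lower k : A k * F (x k) <= estimate k (v k).
Proof.
elim: k => [|k IHk].
  rewrite /estimate /linear_model big_ord0 A_coef0 !mul0r !addr0.
  exact: dprox_ge0.
have uD := v_edom k.+1; set u := v k.+1 in uD *.
have grow := estimate_growth k uD.
have [TD gsub acc] := run.(run_T) k.
pose G := grad f (T k) + g k; pose w := B^-1%VF G.
have GE h : G h = inner B w h by rewrite /inner /w rieszVK.
have {}acc : `|w + (H * `|T k - y k| ^+ n) *: (T k - y k)| <= beta * `|w|.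
  move: acc; rewrite (grad_prox_objective B_self_adjoint B_pos_def normE)// !dual_normE//=.
  rewrite addrAC -/G linearD/=.
  by rewrite rieszK.
(* t is the p-th root of c_p^p |w|, that is, c_p |w|^(1/p) *)
pose t := ((1 - beta) / H * `|w|) `^ n.+1%:R^-1.
have tE : H * t ^+ n.+1 = (1 - beta) * `|w|.
  rewrite powR_invX; last by rewrite mulr_ge0// divr_ge0 ?subr_ge0 ?ltW.
  by field; rewrite gt_eqF.
have t0 : 0 <= t by exact: powR_ge0.
have step := prox_step B_self_adjoint B_pos_def normE H_gt0 beta_ge0 beta_le
  beta_lt1 t0 tE acc.
have coef := coef_estimate H_gt0 beta_lt1 k (normr_ge0 w) (normr_ge0 (u - v k)) t0 tE.
have cs := norm_inner_le B_self_adjoint B_pos_def normE w (u - v k).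
have A0 := A_coef_ge0 n H_gt0 beta_lt1 k.
have A1 := A_coef_ge0 n H_gt0 beta_lt1 k.+1.
have a0 := ltW (a_coef_gt0 n H_gt0 beta_lt1 k).
have fx : F (T k) + inner B w (x k - T k) <= F (x k).
  have := convex_tangent (x k) f_convex (f_diff (T k)).
  have := subdifferential_fine psi_proper gsub TD (x_edom k).
  by rewrite -GE /G add_lfunE; move: (grad f _ _ : R) (g k _ : R) => b c; lra.
have fu : q (T k) + inner B w (u - T k) <=  q u + grad f (T k) (u - T k).
  have := subdifferential_fine psi_proper gsub TD uD.
  by rewrite -GE /G add_lfunE; move: (grad f _ _ : R) (g k _ : R) => b c; lra.
have comb : A k * inner B w (x k - T k) + a k * inner B w (u - T k)
    = - (A k.+1 * inner B w (T k - y k)) + a k * inner B w (u - v k).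
  have yE : A k.+1 * inner B w (y k) = A k * inner B w (x k) + a k * inner B w (v k).
    rewrite run.(run_y) innerDr !innerZr.
    have An : A k.+1 != 0 by rewrite gt_eqF// A_coef_gt0.
    by field.
  rewrite !innerBr// (mulrBr (A k.+1)) yE A_coefS; move: (a k) => ak; ring.
have FT := ler_wpM2l A1 (composite_descent k).
have {}fx := ler_wpM2l A0 fx; have {}fu := ler_wpM2l a0 fu.
have {}step := ler_wpM2l A1 step.
have {}cs : - (a k * (`|w| * `|u - v k|)) <= a k * inner B w (u - v k).
  by rewrite -mulrN ler_wpM2l//; move: cs; rewrite ler_norml => /andP[].
have estS : estimate k.+1 u
    = estimate k u + a k * (f (T k) + grad f (T k) (u - T k) + q u).
  rewrite /estimate linear_modelS A_coefS.
  by move: (f (T k) : R) (grad f (T k) _ : R) (a k) => b c e; ring.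
rewrite estS; apply: le_trans FT _; rewrite A_coefS mulrDl.
have {}coef : 0 <= A k.+1 * (`|w| * t) - a k * (`|w| * `|u - v k|)
  + (2 ^+ n)^-1 * d (u - v k) := coef.
move: IHk grow coef comb fx fu step cs.
move: (f (T k) : R) (f (x k) : R) (grad f (T k) _ : R) => fT fxk gu.
move: (A k.+1 * (`|w| * t)) (a k * (`|w| * _)) (2 ^- n * _) => D1 D2 D3.
move: (A k) (A k.+1) (a k) => D4 D5 D6.
lra.
Qed.

(** The upper bound [linear_model_le] and the lower bounds [estimate_lower]
    and [estimate_growth] compared at one point z. *)
Lemma optimality_gap k z : edom psi z ->
  A k * (F (x k) - F z) + (2 ^+ n)^-1 * d (v k - z) <= d (x 0%N - z).
Proof.
move=> zD; have := estimate_growth k zD; have := estimate_lower k.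
have := linear_model_le k z; rewrite {3}/estimate.
rewrite /dprox -(normrN (z - _)) opprB -(normrN (z - x 0%N)) opprB -!/(dprox _ _).
move: (f z : R) (f (x k) : R) => a b; lra.
Qed.

End AcceleratedRun.

(** * The convergence theorem *)

Lemma A_coefV (R : realType) (n : nat) (H beta : R) (k : nat) :
  0 < H -> beta < 1 -> (0 < k)%N ->
  A_coef n.+1 H beta k *
    (H / (2 * (1 - beta)) * ((2 * n.+1 + 2)%:R / k%:R) ^+ n.+2) = 1.
Proof.
move=> H0 b1 k0.
have d0 : 1 - beta != 0 by rewrite gt_eqF// subr_gt0.
have kn0 : k%:R != 0 :> R by rewrite gt_eqF// ltr0n.
have N0 : n.+2%:R != 0 :> R by rewrite gt_eqF// ltr0n.
have -> : (2 * n.+1 + 2)%:R = 2 * n.+2%:R :> R.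
  by rewrite natrD natrM -[n.+2%:R]natr1; ring.
have -> : 2 * n.+2%:R / k%:R = 2 / (k%:R / n.+2%:R) :> R by rewrite invf_div mulrA.
rewrite /A_coef exprMn c_coefX// [(2 / _) ^+ _]exprMn [2 ^+ n.+2]exprS !exprVn.
have m0 : (k%:R / n.+2%:R) ^+ n.+2 != 0 :> R.
  by rewrite expf_neq0// mulf_neq0// invr_neq0.
by field; rewrite m0 d0 expf_neq0 ?pnatr_eq0// gt_eqF.
Qed.

Theorem theorem2p8 (R : realType) (E : finDimNormedModType R)
    (B : 'Hom(E, 'Hom(E, R^o)))
    (B_self_adjoint : self_adjoint B) (B_pos_def : positive_definite B)
    (normE : norm_induced_by B)
    (f : E -> R^o) (f_convex : @convex_function R E setT f)
    (f_diff : forall z : E, differentiable f z)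
    (psi : E -> \bar R) (psi_proper : proper_efun psi)
    (psi_closed : closed_efun psi) (psi_convex : convex_efun psi)
    (xstar : E) (xstar_opt : argmin_on (edom psi) (composite f psi) xstar)
    (p : nat) (p_ge1 : (1 <= p)%N) (H : R) (H_gt0 : 0 < H)
    (beta : R) (beta_ge0 : 0 <= beta) (beta_le : beta <= 1 / p%:R)
    (beta_lt1 : beta < 1)
    (x v y T : nat -> E) (g : nat -> 'Hom(E, R^o)) (Psi : nat -> E -> \bar R)
    (run : accelerated_run B f psi p H beta x v y T g Psi) :
  [/\ forall k : nat, exists2 Psi_star : \bar R,
        is_min_on (edom psi) (Psi k) Psi_star &
        ((A_coef p H beta k)%:E * composite f psi (x k) <= Psi_star)%E,
      forall k : nat, (1 <= k)%N ->
        (composite f psi (x k) - composite f psi xstar <=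
          (H / (2 * (1 - beta)) * dprox p (x 0%N - xstar)
             * ((2 * p + 2)%:R / k%:R) ^+ p.+1)%:E)%E &
      forall k : nat,
        dprox p (v k - xstar) <= 2 ^+ (p - 1) * dprox p (x 0%N - xstar)].
Proof.
case: p p_ge1 beta_le run => [//|n] _ beta_le run.
have xstarD := xstar_opt.1.
have xD := x_edom run.
have compE z : edom psi z -> composite f psi z = ((f z : R) + fine (psi z))%:E.
  by move=> zD; rewrite /composite EFinD edom_fineK.
have gap k := optimality_gap B_self_adjoint B_pos_def normE f_convex f_diff
  psi_proper psi_convex H_gt0 beta_ge0 beta_le beta_lt1 run k xstarD.
split=> k.
- exists (Psi k (v k)).
    exists (v k) => //; split; first exact: (v_edom psi_proper H_gt0 beta_lt1 run).
    by move=> z _; exact: ((run_v run k).2 z I).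
  rewrite compE// (estimateE psi_proper run); last first.
    exact: (v_edom psi_proper H_gt0 beta_lt1 run).
  rewrite -EFinM lee_fin.
  exact: (estimate_lower B_self_adjoint B_pos_def normE f_convex f_diff
    psi_proper psi_convex H_gt0 beta_ge0 beta_le beta_lt1 run).
- move=> k1; rewrite !compE// -EFinB lee_fin.
  have A0 := A_coef_gt0 n H_gt0 beta_lt1 k1.
  rewrite -(ler_pM2l A0) [in leRHS](mulrAC (H / _)) [leRHS]mulrA A_coefV// mul1r.
  apply: le_trans (gap k); rewrite lerDl mulr_ge0 ?dprox_ge0//.
- rewrite subn1 /= -ler_pdivrMl ?exprn_gt0//.
  apply: le_trans (gap k); rewrite lerDr mulr_ge0 ?A_coef_ge0// subr_ge0.
  by rewrite -lee_fin -!compE//; exact: xstar_opt.2.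
Qed.
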